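(* For every prime power $q \geq 4$, the graph $H_q$ (which has $q^4-q^3+q^2$ vertices) is quasi-Folkman with distinguished family $\mathscr{T}_q$; that is, no four triangles in $\mathscr{T}_q$ induce a $K_4$ in $H_q$, and every two-coloring of $E(H_q)$ induces a monochromatic triangle belonging to $\mathscr{T}_q$. Moreover, as $q \to \infty$ (over prime powers), every two-coloring of $E(H_q)$ induces at least $(\tfrac14 - o(1))|\mathscr{T}_q|$ monochromatic triangles belonging to $\mathscr{T}_q$.
   Context: Let $q$ be a prime power and $PG(2,q^2)$ the projective plane over $\mathbb{F}_{q^2}$. The Hermitian unital is $\mathscr{U}_q = \{\langle X,Y,Z\rangle : X^{q+1}+Y^{q+1}+Z^{q+1}=0\}$, a set of points of $PG(2,q^2)$ (here $\langle X,Y,Z\rangle$ is the 1-dimensional subspace spanned by a nonzero vector of $\mathbb{F}_{q^2}^3$). Every line of $PG(2,q^2)$ meets $\mathscr{U}_q$ in exactly $1$ or exactly $q+1$ points; lines meeting it in $q+1$ points are called secants, and $\mathscr{L}_q$ denotes the set of secants. The graph $H_q$ has vertex set $\{v_\ell : \ell \in \mathscr{L}_q\}$, with $v_{\ell_1} \sim v_{\ell_2}$ iff $\ell_1 \neq \ell_2$ and $\ell_1 \cap \ell_2 \in \mathscr{U}_q$. A triangle $v_{\ell_1}v_{\ell_2}v_{\ell_3}$ of $H_q$ is non-degenerate if the three points $\ell_1\cap\ell_2$, $\ell_2\cap\ell_3$, $\ell_1\cap\ell_3$ (all in $\mathscr{U}_q$) are pairwise distinct; $\mathscr{T}_q$ is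 the set of non-degenerate triangles of $H_q$. A graph $G$ is quasi-Folkman if there is a family $\mathscr{T}$ of triangles of $G$ such that (1) no four triangles of $\mathscr{T}$ are the four triangles of a $K_4$ in $G$, and (2) every two-coloring of $E(G)$ has a monochromatic triangle in $\mathscr{T}$. *)

(* Defs.v *)
From HB Require Import structures.
From mathcomp Require Import all_boot all_order all_algebra all_field.
Set Implicit Arguments. Unset Strict Implicit. Unset Printing Implicit Defensive.
Import Order.TTheory GRing.Theory Num.Theory.
Local Open Scope ring_scope.

Definition prime_power (q : nat) : Prop :=
  exists p k : nat, [/\ prime p, (0 < k)%N & q = (p ^ k)%N].

Section Graphs.
Variable T : finType.
Variables (S : {set T}) (e : rel T).

Definition triangles : {set {set T}} :=
  [set t : {set T} | [&& t \subset S, #|t| == 3%N &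
     [forall x in t, forall y in t, (x != y) ==> e x y]]].

Definition edges : {set {set T}} :=
  [set E : {set T} | [&& E \subset S, #|E| == 2%N &
     [forall x in E, forall y in E, (x != y) ==> e x y]]].

(* a 2-colouring of E(G) is any c : {set T} -> bool (only its values on
   edges matter); a triangle t is monochromatic if all its edges get the
   same colour *)
Definition monochromatic (c : {set T} -> bool) (t : {set T}) : bool :=
  [exists b : bool, forall E : {set T},
     ((E \subset t) && (#|E| == 2%N)) ==> (c E == b)].

Definition is_K4 (K : {set T}) : bool :=
  [&& K \subset S, #|K| == 4%N &
     [forall x in K, forall y in K, (x != y) ==> e x y]].

Definition quasi_folkman_with (Tf : {set {set T}}) : Prop :=
  [/\ Tf \subset triangles,
      (forall K : {set T}, is_K4 K ->
         ~ (forall t : {set T}, t \subset K -> #|t| = 3%N -> t \in Tf))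
    &
      (forall c : {set T} -> bool, exists2 t, t \in Tf & monochromatic c t)].
End Graphs.

(* ---------- The projective plane PG(2, F), F = F_{q^2} ------------------- *)
Section Hermitian.
Variable F : finFieldType.
Variable q : nat.

Definition vec := 'rV[F]_3.

Definition pt (v : vec) : {set vec} := [set a *: v | a : F].

Definition nzvecs : {set vec} := [set v : vec | v != 0].

Definition points : {set {set vec}} := pt @: nzvecs.

Definition unital : {set {set vec}} :=
  pt @: [set v : vec | (v != 0) && (\sum_(i < 3) (v 0 i) ^+ q.+1 == 0)].

Definition dot (v w : vec) : F := \sum_(i < 3) v 0 i * w 0 i.

Definition line (w : vec) : {set {set vec}} :=
  pt @: [set v : vec | (v != 0) && (dot v w == 0)].

Definition lines : {set {set {set vec}}} := line @: nzvecs.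

Definition secants : {set {set {set vec}}} :=
  [set l in lines | #|l :&: unital| == q.+1].

Definition Hadj : rel {set {set vec}} :=
  fun l1 l2 => (l1 != l2) && (l1 :&: l2 :&: unital != set0).

(* the intersection point of two lines (unique for distinct lines) *)
Definition meet (l1 l2 : {set {set vec}}) : option {set vec} :=
  [pick p in l1 :&: l2].

Definition nondegenerate (t : {set {set {set vec}}}) : bool :=
  [forall a in t, forall b in t, forall c in t,
     [&& a != b, a != c & b != c] ==> (meet a b != meet a c)].

Definition Tq : {set {set {set {set vec}}}} :=
  [set t in triangles secants Hadj | nondegenerate t].
End Hermitian.

(* Main.v *)
(* Goodman counting. A nondegenerate triangle that is not monochromatic has two
   sides at which its two edges get different colours. A triangle with a side l
   is an antiflag (l, C) together with two unital points of l, and colouring a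
   unital point A of l by the colour of {l, CA} shows that, for fixed (l, C), at
   most (q + 1)^2 / 4 of the C(q + 1, 2) triangles are bichromatic at l. Hence
   at most a fraction 3 (q + 1) / (4 q) of the triangles is not monochromatic.

   The six edges of a K4 whose triangles are all nondegenerate would be the six
   points of an O'Nan configuration. In suitable coordinates a, b, c, b - c,
   c - a and b - a would all be isotropic, so the Gram matrix of the Hermitian
   form on a, b, c would be alternating of order 3, hence singular. *)
Require Import Defs.
From HB Require Import structures.
From mathcomp Require Import all_boot all_order all_algebra all_field.
From mathcomp Require Import zify ring lra.
Import Order.TTheory GRing.Theory Num.Theory.
Set Implicit Arguments. Unset Strict Implicit. Unset Printing Implicit Defensive.

(** * Triangles in a linear space on q^3 + 1 points whose lines carry q + 1 points each *)

Section LinearSpace.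
Variables (T : finType) (U : {set T}) (L : {set {set T}}) (q : nat).
Hypothesis card_block : forall l, l \in L -> #|l :&: U| = q.+1.
Hypothesis exists_join : forall A B, A \in U -> B \in U -> A != B ->
  exists l, [/\ l \in L, A \in l & B \in l].
Hypothesis meet_unique : forall l m A B, l \in L -> m \in L -> l != m ->
  A \in l -> A \in m -> B \in l -> B \in m -> A = B.
Hypothesis card_U : #|U| = (q ^ 3).+1.

Definition adj : rel {set T} :=
  fun l m => (l != m) && (l :&: m :&: U != set0).

(** Non-degeneracy is encoded as the absence of a point common to all three lines;
    [Tq_nondeg_triangles] identifies this family with [Tq]. *)
Definition nondeg_triangles : {set {set {set T}}} :=
  [set t in triangles L adj | [forall A, exists l in t, A \notin l]].

(** The default [set0] is never reached for distinct points of [U], by [joinP]. *)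
Definition join A B : {set T} :=
  odflt set0 [pick l in L | (A \in l) && (B \in l)].

Lemma joinP A B : A \in U -> B \in U -> A != B ->
  [/\ join A B \in L, A \in join A B & B \in join A B].
Proof.
move=> AU BU neAB; rewrite /join; case: pickP => [l /and3P[] //|].
have [l [lL Al Bl]] := exists_join AU BU neAB.
by move=> /(_ l); rewrite lL Al Bl.
Qed.

Lemma join_eq l A B : A \in U -> B \in U -> A != B ->
  l \in L -> A \in l -> B \in l -> join A B = l.
Proof.
move=> AU BU neAB lL Al Bl; have [jL Aj Bj] := joinP AU BU neAB.
by apply/eqP/negP => /negP ne; move/eqP: neAB; apply; apply: (meet_unique jL lL ne).
Qed.

(** Ordered pairs of distinct points of [U] are counted twice: directly, and sorted by the line that
    joins them. *)
Lemma card_lines : (#|L| * (q.+1 * q) = (q ^ 3).+1 * q ^ 3)%N.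
Proof.
pose D := [set x : T * T | [&& x.1 \in U, x.2 \in U & x.1 != x.2]].
have cardD (V : {set T}) :
  #|[set x : T * T | [&& x.1 \in V, x.2 \in V & x.1 != x.2]]| = (#|V| * #|V|.-1)%N.
  rewrite -sum1_card (eq_bigl (fun x => (x.1 \in V) && (x.2 \in V :\ x.1))); last first.
    by move=> x; rewrite !inE eq_sym; case: (x.1 \in V); rewrite //= andbC.
  rewrite -(pair_big_dep (fun a => a \in V) (fun a b => b \in V :\ a) (fun _ _ => 1%N)) /=.
  rewrite -sum_nat_const; apply: eq_bigr => a aV.
  by rewrite sum1_card (cardsD1 a V) aV.
have := cardD U; rewrite card_U /= => <-; rewrite -[RHS]sum1_card.
rewrite [RHS](partition_big (fun x => join x.1 x.2) (mem L)) /=; last first.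
  by move=> [a b]; rewrite inE /= => /and3P[aU bU ab]; case: (joinP aU bU ab).
rewrite -sum_nat_const; apply: eq_bigr => l lL.
have := cardD (l :&: U); rewrite (card_block lL) /= => <-.
rewrite -[LHS]sum1_card; apply: eq_bigl => -[a b]; rewrite !inE /=.
apply/and3P/andP=> [[/andP[al aU] /andP[bl bU] ab]|[/and3P[aU bU ab] /eqP jl]].
  by rewrite aU bU ab (join_eq aU bU ab lL al bl).
by have [_] := joinP aU bU ab; rewrite jl aU bU ab => -> ->.
Qed.

Lemma card_off l : l \in L -> #|U :\: l| = (q ^ 3 - q)%N.
Proof.
by move=> lL; have := cardsID l U; rewrite setIC card_block // card_U; lia.
Qed.

Lemma cards3_mem (V : finType) (t : {set V}) (x : V) : #|t| = 3%N -> x \in t ->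
  exists y z, [/\ t = [set x; y; z], x != y, x != z & y != z].
Proof.
move=> ct xt; have : #|t :\ x| == 2%N by have := cardsD1 x t; rewrite xt ct add1n => -[<-].
case/cards2P => y [z [yz E]]; exists y, z.
have yt : y \in t :\ x by rewrite E !inE eqxx.
have zt : z \in t :\ x by rewrite E !inE eqxx orbT.
move: yt zt; rewrite !inE => /andP[yx _] /andP[zx _].
split; rewrite // 1?eq_sym //.
by rewrite -setUA -E setD1K.
Qed.

(** Seen from the side [l], a triangle is an antiflag with two points: [A] and [B] are where the
    other sides meet [l], and [C] is the opposite corner. If [C] were on [l], or [A = B], the three
    lines would be concurrent. *)
Lemma triangleP t l : t \in nondeg_triangles -> l \in t ->
  exists A B C, [/\ l \in L, A \in l :&: U, B \in l :&: U, A != B &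
    C \in U :\: l /\ t = [set l; join C A; join C B]].
Proof.
rewrite !inE => /andP[/and3P[tL /eqP ct /forall_inP adjt] /forallP ndt] lt.
have [m [n [Et lm ln mn]]] := cards3_mem ct lt.
have mt : m \in t by rewrite Et !inE eqxx orbT.
have nt : n \in t by rewrite Et !inE eqxx !orbT.
have lL := subsetP tL _ lt; have mL := subsetP tL _ mt; have nL := subsetP tL _ nt.
have mt_adj x y : x \in t -> y \in t -> x != y -> exists A, [/\ A \in x, A \in y & A \in U].
  move=> xt yt xy; have /forall_inP/(_ _ yt) := adjt _ xt.
  by rewrite xy /adj xy /= => /set0Pn[A]; rewrite !inE => /andP[/andP[]]; exists A.
have [A [Al Am AU]] := mt_adj _ _ lt mt lm.
have [B [Bl Bn BU]] := mt_adj _ _ lt nt ln.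
have [C [Cm Cn CU]] := mt_adj _ _ mt nt mn.
have common X : X \in l -> X \in m -> X \in n -> False.
  move=> Xl Xm Xn; have /exists_inP[k] := ndt X.
  by rewrite Et !inE => /orP[/orP[]|] /eqP ->; rewrite ?Xl ?Xm ?Xn.
have CA : C != A by apply/eqP => E; apply: (common A) => //; rewrite -E.
have CB : C != B by apply/eqP => E; apply: (common B) => //; rewrite -E.
have Cl : C \notin l by apply/negP => Cl; apply: (common C).
exists A, B, C; rewrite !inE Al AU Bl BU CU Cl (join_eq CU AU CA mL Cm Am).
rewrite (join_eq CU BU CB nL Cn Bn); split => //.
by apply/eqP => E; apply: (common A) => //; rewrite E.
Qed.

Lemma triangle_in l A B C : l \in L -> A \in l :&: U -> B \in l :&: U -> A != B ->
  C \in U :\: l -> [set l; join C A; join C B] \in nondeg_triangles.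
Proof.
rewrite !inE => lL /andP[Al AU] /andP[Bl BU] AB /andP[Cl CU].
have ne X : X \in l -> C != X by move=> Xl; apply: contraNneq Cl => ->.
have [mL Cm Am] := joinP CU AU (ne _ Al).
have [nL Cn Bn] := joinP CU BU (ne _ Bl).
set m := join C A in mL Cm Am *; set n := join C B in nL Cn Bn *.
have lm : l != m by apply: contraNneq Cl => ->.
have ln : l != n by apply: contraNneq Cl => ->.
have mn : m != n.
  apply: contraNneq AB => E; apply/eqP; apply: (meet_unique lL mL lm) => //.
  by rewrite E.
have a1 : adj l m by rewrite /adj lm; apply/set0Pn; exists A; rewrite !inE Al Am.
have a2 : adj l n by rewrite /adj ln; apply/set0Pn; exists B; rewrite !inE Bl Bn.
have a3 : adj m n by rewrite /adj mn; apply/set0Pn; exists C; rewrite !inE Cm Cn.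
have adjC x y : adj x y = adj y x by rewrite /adj eq_sym [x :&: y]setIC.
apply/andP; split; [apply/and3P; split|].
- by apply/subsetP => x; rewrite !inE => /orP[/orP[]|] /eqP->.
- by rewrite setUC cardsU1 cards2 lm !inE negb_or [n == l]eq_sym ln [n == m]eq_sym mn.
- apply/forall_inP => x xt; apply/forall_inP => y yt; apply/implyP.
  move: xt yt; rewrite !inE => /orP[/orP[]|] /eqP-> /orP[/orP[]|] /eqP->;
  by rewrite ?eqxx // ?a1 ?a2 ?a3 // adjC ?a1 ?a2 ?a3.
- apply/forallP => X; apply/exists_inP.
  have [Xl|Xl] := boolP (X \in l); last by exists l; rewrite ?inE ?eqxx.
  have [Xm|Xm] := boolP (X \in m); last by exists m; rewrite ?inE ?eqxx ?orbT.
  exists n; rewrite ?inE ?eqxx ?orbT //; apply: contra Cl => Xn.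
  by rewrite (meet_unique mL nL mn Cm Cn Xm Xn).
Qed.

Lemma nondeg_triangle_sub t : t \in nondeg_triangles -> t \subset L /\ #|t| = 3%N.
Proof. by rewrite !inE => /andP[/and3P[-> /eqP]]. Qed.

(** The map [f] sends a point [C] off [l] and a pair of points of [l] to a triangle. It is
    injective: the two other sides give back the pair where they meet [l], and [C] where they meet
    each other. *)
Lemma card_triangles_through l : l \in L ->
  ((q ^ 3 - q) * 'C(q.+1, 2) <= #|[set t in nondeg_triangles | l \in t]|)%N.
Proof.
move=> lL; pose P2 := [set E : {set T} | E \subset l :&: U & #|E| == 2%N].
have inP2 E A : E \in P2 -> A \in E -> A \in l /\ A \in U.
  by rewrite inE => /andP[/subsetP sE _] /sE; rewrite inE => /andP[].
pose f (x : T * {set T}) := l |: [set join x.1 A | A in x.2].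
have joinC C A : C \in U :\: l -> A \in l -> A \in U ->
    [/\ join C A \in L, join C A != l, C \in join C A & A \in join C A].
  rewrite inE => /andP[Cl CU] Al AU.
  have CA : C != A by apply: contraNneq Cl => ->.
  have [jL Cj Aj] := joinP CU AU CA.
  by split => //; apply: contraNneq Cl => <-.
have finj : {in setX (U :\: l) P2 &, injective f}.
  have fsub C C' E E' : C \in U :\: l -> C' \in U :\: l -> E \in P2 -> E' \in P2 ->
      f (C, E) = f (C', E') -> forall A, A \in E ->
      exists A', [/\ A' \in E', A' \in join C A, C' \in join C A & join C A = join C' A'].
    move=> CU C'U EP E'P eqf A AE; have [Al AU] := inP2 _ _ EP AE.
    have [jL jl Cj Aj] := joinC _ _ CU Al AU.
    have : join C A \in f (C, E) by rewrite inE imset_f ?orbT.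
    rewrite eqf !inE (negbTE jl) => /imsetP[A' A'E' E1]; exists A'.
    have [A'l A'U] := inP2 _ _ E'P A'E'.
    by have [_ _ C'j A'j] := joinC _ _ C'U A'l A'U; rewrite E1.
  have sub C E E' : C \in U :\: l -> E \in P2 -> E' \in P2 ->
      f (C, E) = f (C, E') -> E \subset E'.
    move=> CU EP E'P eqf; apply/subsetP => A AE.
    have [A' [A'E' A'j _ _]] := fsub _ _ _ _ CU CU EP E'P eqf _ AE.
    have [Al AU] := inP2 _ _ EP AE; have [A'l A'U] := inP2 _ _ E'P A'E'.
    have [jL jl Cj Aj] := joinC _ _ CU Al AU.
    by rewrite (meet_unique jL lL jl Aj Al A'j A'l).
  move=> [C E] [C' E'] /setXP[/= CU EP] /setXP[/= C'U E'P] eqf.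
  (* Both [C] and [C'] lie on [join C A] and on [join C B], and these lines differ because they meet
     [l] in different points. *)
  have CC' : C = C'.
    have := EP; rewrite inE => /andP[_ /cards2P[A [B [AB EE]]]].
    have AE : A \in E by rewrite EE !inE eqxx.
    have BE : B \in E by rewrite EE !inE eqxx orbT.
    have [_ [_ _ C'A _]] := fsub _ _ _ _ CU C'U EP E'P eqf _ AE.
    have [_ [_ _ C'B _]] := fsub _ _ _ _ CU C'U EP E'P eqf _ BE.
    have [Al AU] := inP2 _ _ EP AE; have [Bl BU] := inP2 _ _ EP BE.
    have [jL jl Cj Aj] := joinC _ _ CU Al AU.
    have [kL kl Ck Bk] := joinC _ _ CU Bl BU.
    apply: (meet_unique jL kL) => //; apply: contraNneq AB => jk.
    by rewrite (meet_unique jL lL jl Aj Al _ Bl) // jk.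
  subst C'; congr (_, _); apply/eqP; rewrite eqEsubset.
  by rewrite (sub C E E') // (sub C E' E).
have <- : #|f @: setX (U :\: l) P2| = ((q ^ 3 - q) * 'C(q.+1, 2))%N.
  by rewrite card_in_imset // cardsX card_off // cards_draws card_block.
apply: subset_leq_card; apply/subsetP => _ /imsetP[[C E] /setXP[/= CU EP] ->].
rewrite inE [f _]/f /= setU11 andbT.
have := EP; rewrite inE => /andP[_ /cards2P[A [B [AB EE]]]].
have AE : A \in E by rewrite EE !inE eqxx.
have BE : B \in E by rewrite EE !inE eqxx orbT.
have [Al AU] := inP2 _ _ EP AE; have [Bl BU] := inP2 _ _ EP BE.
by rewrite EE imsetU1 imset_set1 setUA triangle_in // inE ?Al ?Bl.
Qed.

(** Incident pairs of a line and a triangle are counted. The factor 6 is 3 for the sides of a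
    triangle times 2 for the denominator of the binomial coefficient. *)
Lemma card_nondeg_triangles :
  (#|L| * ((q ^ 3 - q) * (q.+1 * q)) <= 6 * #|nondeg_triangles|)%N.
Proof.
have -> : (6 * #|nondeg_triangles| =
    2 * \sum_(l in L) #|[set t in nondeg_triangles | l \in t]|)%N.
  suff -> : (\sum_(l in L) #|[set t in nondeg_triangles | l \in t]| =
    3 * #|nondeg_triangles|)%N by rewrite mulnA.
  under eq_bigr => l _ do rewrite -sum1dep_card.
  rewrite (exchange_big_dep (mem nondeg_triangles)) /=; last by move=> l t _ /andP[].
  rewrite mulnC -sum_nat_const; apply: eq_bigr => t tN.
  have [/subsetP tL <-] := nondeg_triangle_sub tN.
  rewrite sum1dep_card; apply: eq_card => l.
  by rewrite in_set tN andbC /=; case: (boolP (l \in t)) => // /tL ->.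
rewrite -sum_nat_const big_distrr /=; apply: leq_sum => l lL.
have := card_triangles_through lL; rewrite bin2 /=.
(* The product q (q + 1) is even, so the halving in [bin2] is exact. *)
have := odd_double_half (q.+1 * q); rewrite oddM /= andNb add0n -mul2n.
nia.
Qed.

(** * Two-colourings: bounding the triangles that are not monochromatic *)

Section Colouring.
Variable c : {set {set T}} -> bool.

(** Lines are the vertices of the graph, so an edge is a pair of lines, and the two edges compared
    here are those of [t] at the vertex [l]. *)
Definition bichromatic (t : {set {set T}}) (l : {set T}) : bool :=
  [exists m in t, exists n in t, [&& m != l, n != l, c [set l; m] & ~~ c [set l; n]]].

Lemma bichromaticP (t : {set {set T}}) l m n : m \in t -> n \in t -> m != l -> n != l ->
  c [set l; m] != c [set l; n] -> bichromatic t l.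
Proof.
move=> mt nt ml nl cne; apply/exists_inP.
case E : (c [set l; m]) cne; case E' : (c [set l; n]) => // _.
  by exists m => //; apply/exists_inP; exists n => //; rewrite ml nl E E'.
by exists n => //; apply/exists_inP; exists m => //; rewrite ml nl E E'.
Qed.

(** Among three edges that do not all agree, one has a colour different from the two others; both of
    its ends are bichromatic. *)
Lemma two_bichromatic (t : {set {set T}}) : #|t| = 3%N -> ~~ monochromatic c t ->
  (1 < #|[set l in t | bichromatic t l]|)%N.
Proof.
move=> ct nm; have [x xt] : exists x, x \in t by apply/set0Pn; rewrite -card_gt0 ct.
have [y [z [Et xy xz yz]]] := cards3_mem ct xt.
have yt : y \in t by rewrite Et !inE eqxx orbT.
have zt : z \in t by rewrite Et !inE eqxx !orbT.
have {}nm : ~~ ((c [set x; y] == c [set x; z]) && (c [set x; y] == c [set y; z])).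
  apply: contra nm => /andP[/eqP c1 /eqP c2].
  apply/existsP; exists (c [set x; y]); apply/forallP => E.
  apply/implyP => /andP[/subsetP sE /cards2P[a [b [ab EE]]]].
  have : a \in t by apply: sE; rewrite EE !inE eqxx.
  have : b \in t by apply: sE; rewrite EE !inE eqxx orbT.
  move: ab; rewrite EE Et !inE => ab /orP[/orP[]|] /eqP Eb /orP[/orP[]|] /eqP Ea;
    move: ab; rewrite Ea Eb ?eqxx // => _; rewrite ?[[set y; x]]setUC
    ?[[set z; x]]setUC ?[[set z; y]]setUC -?c1 -?c2 //.
have bi u v w : u \in t -> v \in t -> w \in t -> v != u -> w != u ->
    c [set u; v] != c [set u; w] -> u \in [set l in t | bichromatic t l].
  by move=> ut vt wt vu wu cne; rewrite inE ut (bichromaticP vt wt).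
have two u v : u != v -> u \in [set l in t | bichromatic t l] ->
    v \in [set l in t | bichromatic t l] -> (1 < #|[set l in t | bichromatic t l]|)%N.
  move=> uv ub vb; have <- : #|[set u; v]| = 2%N by rewrite cards2 uv.
  by apply: subset_leq_card; apply/subsetP => w; rewrite !inE => /orP[] /eqP ->;
    [move: ub | move: vb]; rewrite inE.
have [yx zx zy] : [/\ y != x, z != x & z != y] by rewrite ![_ == x]eq_sym [z == y]eq_sym.
have [e1|n1] := eqVneq (c [set x; y]) (c [set x; z]).
  have n2 : c [set x; y] != c [set y; z] by move: nm; rewrite e1 eqxx.
  apply: (two y z) => //; first by apply: (bi y x z); rewrite // setUC.
  by apply: (bi z x y); rewrite // [[set z; x]]setUC [[set z; y]]setUC -e1.
have xb : x \in [set l in t | bichromatic t l] by apply: (bi x y z).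
have [e2|n2] := eqVneq (c [set x; y]) (c [set y; z]).
  apply: (two x z) => //; apply: (bi z x y); rewrite // [[set z; x]]setUC.
  by rewrite [[set z; y]]setUC -e2 eq_sym.
by apply: (two x y) => //; apply: (bi y x z); rewrite // setUC.
Qed.

(** There are q^3 - q choices of [C]. Each splits the points of [l] into colour classes of sizes r
    and b with r + b = q + 1; a triangle bichromatic at [l] takes one point from each class, and 4 r
    b is at most (r + b)^2. *)
Lemma card_bichromatic l : l \in L ->
  (4 * #|[set t in nondeg_triangles | (l \in t) && bichromatic t l]| <=
   (q ^ 3 - q) * q.+1 ^ 2)%N.
Proof.
move=> lL; pose R C := [set A in l :&: U | c [set l; join C A]].
pose B C := [set A in l :&: U | ~~ c [set l; join C A]].
pose D := [set x : T * (T * T) | (x.1 \in U :\: l) && (x.2 \in setX (R x.1) (B x.1))].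
pose f (x : T * (T * T)) := [set l; join x.1 x.2.1; join x.1 x.2.2].
have sub : [set t in nondeg_triangles | (l \in t) && bichromatic t l] \subset f @: D.
  apply/subsetP => t; rewrite inE => /and3P[tN lt /exists_inP[m mt]].
  move=> /exists_inP[n nt /and4P[ml nl cm cn]].
  have [X [Y [C [_ Xl Yl _ [CU Et]]]]] := triangleP tN lt.
  move: mt nt; rewrite Et !inE (negbTE ml) (negbTE nl) /= => mt nt.
  have [[Em En]|[Em En]] : (m = join C X /\ n = join C Y) \/ (m = join C Y /\ n = join C X).
  - move: mt nt cm cn => /orP[] /eqP-> /orP[] /eqP->; tauto || (by move=> ->).
  - apply/imsetP; exists (C, (X, Y)); rewrite ?inE //= -Em -En cm cn.
    by move: CU Xl Yl; rewrite !inE => -> -> ->.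
  - apply/imsetP; exists (C, (Y, X)); rewrite ?inE //=.
    by rewrite -Em -En cm cn; move: CU Xl Yl; rewrite !inE => -> -> ->.
    by rewrite /f /= setUAC.
apply: (@leq_trans (4 * #|D|)); first by
  rewrite leq_mul2l (leq_trans (subset_leq_card sub)) // leq_imset_card.
rewrite -sum1dep_card -(pair_big_dep (fun C => C \in U :\: l)
  (fun C x => x \in setX (R C) (B C)) (fun _ _ => 1%N)) /= -(card_off lL).
rewrite -sum_nat_const big_distrr /=; apply: leq_sum => C _.
have -> : q.+1 = (#|R C| + #|B C|)%N; last by rewrite sum1_card cardsX nat_AGM2.
rewrite -(card_block lL) -(cardsID [set A | c [set l; join C A]]).
by congr (_ + _)%N; apply: eq_card => A; rewrite !inE // andbC.
Qed.

Lemma card_nonmono :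
  (4 * q * #|[set t in nondeg_triangles | ~~ monochromatic c t]| <=
   3 * q.+1 * #|nondeg_triangles|)%N.
Proof.
have H : (2 * #|[set t in nondeg_triangles | ~~ monochromatic c t]| <=
    \sum_(l in L) #|[set t in nondeg_triangles | (l \in t) && bichromatic t l]|)%N.
  under eq_bigr => l _ do rewrite -sum1dep_card.
  rewrite (exchange_big_dep (mem nondeg_triangles)) /=; last by move=> l t _ /andP[].
  rewrite mulnC -sum_nat_const [leqRHS](bigID (fun t => monochromatic c t)) /=.
  apply: leq_trans (leq_addl _ _).
  rewrite (eq_bigl (fun t => (t \in nondeg_triangles) && ~~ monochromatic c t)); last first.
    by move=> t; rewrite inE.
  apply: leq_sum => t /andP[tN nm]; rewrite sum1dep_card.
  have [/subsetP tL ct] := nondeg_triangle_sub tN.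
  apply: leq_trans (two_bichromatic ct nm) _.
  apply: subset_leq_card; apply/subsetP => l; rewrite in_set => /andP[lt bl].
  by rewrite in_set tN lt bl tL.
have H2 : (4 * \sum_(l in L) #|[set t in nondeg_triangles | (l \in t) && bichromatic t l]| <=
    #|L| * ((q ^ 3 - q) * q.+1 ^ 2))%N.
  by rewrite -sum_nat_const big_distrr /=; apply: leq_sum => l /card_bichromatic.
have H3 := card_nondeg_triangles.
set N := #|[set t in _ | _]| in H *; set S := (\sum_(l in L) _)%N in H H2.
rewrite -(leq_pmul2l (isT : 0 < 2)%N).
(* Both sides are compared with |L| (q^3 - q) q (q + 1)^2, which is q + 1 times the lower bound for
   triangles and q times the upper bound for bichromatic sides. *)
apply: (@leq_trans (q.+1 * (6 * #|nondeg_triangles|))%N); last by lia.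
apply: leq_trans (leq_mul (leqnn _) H3).
apply: (@leq_trans (q * (4 * S))%N); first by move: (leq_mul (leqnn (4 * q)) H); lia.
apply: leq_trans (leq_mul (leqnn _) H2) _.
by rewrite -mulnn; apply: eq_leq; lia.
Qed.
End Colouring.
End LinearSpace.

(** * Fibre counting, and the trace and norm maps of the involution x -> x^q *)

Local Open Scope ring_scope.

(** With at most b fibres of at most k elements and b k elements altogether, no fibre can fall short
    of k. Upper bounds from polynomial roots thus become exact counts. *)
Lemma card_fiber_eq (T1 T2 : finType) (A : {set T1}) (B : {set T2}) (f : T1 -> T2) (b k : nat) :
  {in A, forall x, f x \in B} -> (#|B| <= b)%N ->
  {in B, forall y, #|[set x in A | f x == y]| <= k}%N -> #|A| = (b * k)%N ->
  {in B, forall y, #|[set x in A | f x == y]| = k}.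
Proof.
move=> fAB cB cf cA y yB; apply/eqP; rewrite eqn_leq cf //= leqNgt; apply/negP => lt.
have : (#|A| <= \sum_(z in B) #|[set x in A | f x == z]|)%N.
  rewrite -sum1_card (partition_big f (mem B)) //=.
  by apply: leq_sum => z _; rewrite sum1dep_card.
rewrite leqNgt => /negP; apply; rewrite (bigD1 y) //=.
apply: (@leq_trans (k + \sum_(z in B | z != y) k)); last first.
  have -> : (k + \sum_(z in B | z != y) k = \sum_(z in B) k)%N by rewrite [RHS](bigD1 y).
  by rewrite sum_nat_const cA leq_mul2r cB orbT.
by rewrite -addSn leq_add // leq_sum // => z /andP[zB _]; apply: cf.
Qed.

Lemma card_roots_lt (F : finFieldType) (p : {poly F}) :
  p != 0 -> (#|[set x | root p x]| < size p)%N.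
Proof.
move=> p0; rewrite cardE; apply: max_poly_roots => //; last exact: enum_uniq.
by apply/allP => x; rewrite mem_enum inE.
Qed.

Section Conjugation.
Variables (F : finFieldType) (q : nat).
Hypotheses (hq : prime_power q) (hF : #|F| = (q ^ 2)%N).

Lemma q_gt1 : (1 < q)%N.
Proof.
have [p [k [pp k0 ->]]] := hq.
by rewrite -(exp1n k) ltn_exp2r // prime_gt1.
Qed.

Lemma conjK (x : F) : (x ^+ q) ^+ q = x.
Proof. by rewrite -exprM -[(q * q)%N]/(q ^ 2)%N -hF expf_card. Qed.

Lemma pchar_q : [pchar F].-nat q.
Proof.
have [p [k [pp k0 Eq]]] := hq.
have pF : p \in [pchar F].
  by apply: (@card_finPcharP _ _ (k * 2)%N) => //; rewrite hF Eq expnM.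
by rewrite (eq_pnat _ (pcharf_eq pF)) Eq pnatX pnat_id.
Qed.

Lemma conjD (x y : F) : (x + y) ^+ q = x ^+ q + y ^+ q.
Proof. exact: (exprDn_pchar _ _ pchar_q). Qed.

Lemma conj0 : 0 ^+ q = 0 :> F.
Proof. by rewrite expr0n; case: q q_gt1. Qed.

Lemma conjN (x : F) : (- x) ^+ q = - x ^+ q.
Proof. by apply/eqP; rewrite -addr_eq0 -conjD addNr conj0. Qed.

(** The trace takes values among the at most q roots of X^q - X, and each fibre consists of roots of
    a polynomial of degree q; since q^2 = q q, all fibres have size q. *)
Lemma card_trace0 : #|[set t : F | t ^+ q + t == 0]| = q.
Proof.
have q1 := q_gt1.
have H := @card_fiber_eq F F setT [set c | c ^+ q == c] (fun t => t ^+ q + t) q q.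
rewrite -[RHS](H _ _ _ _ 0); first by apply: eq_card => t; rewrite !inE.
- by move=> t _; rewrite inE conjD conjK addrC.
- have nz : 'X^q - 'X != 0 :> {poly F}.
    by rewrite -size_poly_gt0 size_polyDl ?size_polyXn // size_polyN size_polyX.
  have := card_roots_lt nz.
  rewrite size_polyDl ?size_polyXn // ?size_polyN ?size_polyX // ltnS.
  apply: leq_trans; rewrite subset_leq_card //; apply/subsetP => x; rewrite !inE.
  by rewrite rootE !hornerE subr_eq0.
- move=> c _; have sz : size ('X - c%:P : {poly F}) = 2 by rewrite size_XsubC.
  have nz : 'X^q + ('X - c%:P) != 0 :> {poly F}.
    by rewrite -size_poly_gt0 size_polyDl ?size_polyXn // sz.
  have := card_roots_lt nz.
  rewrite size_polyDl ?size_polyXn ?sz // ltnS.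
  apply: leq_trans; rewrite subset_leq_card //; apply/subsetP => x; rewrite !inE.
  by rewrite rootE !hornerE ?addrA subr_eq0.
- by rewrite cardsT hF.
- by rewrite inE conj0.
Qed.

(** The norm sends the q^2 - 1 nonzero elements to the at most q - 1 roots of X^(q-1) - 1, with
    fibres of at most q + 1 elements; since q^2 - 1 = (q - 1)(q + 1), all fibres are full. *)
Lemma card_norm (c : F) : c ^+ q = c ->
  #|[set z : F | z ^+ q.+1 == c]| = if c == 0 then 1%N else q.+1.
Proof.
have q1 := q_gt1; move=> cq; case: eqVneq => [->|c0].
  by rewrite -(cards1 (0 : F)); apply: eq_card => z; rewrite !inE expf_eq0.
have H := @card_fiber_eq F F [set~ 0] [set c | c ^+ q.-1 == 1]
  (fun z => z ^+ q.+1) q.-1 q.+1.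
have E1 (x : F) : x != 0 -> x ^+ q = x -> x ^+ q.-1 == 1.
  move=> x0 xq; rewrite -(inj_eq (mulfI x0)) mulr1 -exprS prednK ?xq //; lia.
rewrite -[RHS](H _ _ _ _ c).
- apply: eq_card => z; rewrite !inE; case: (eqVneq z 0) => [->|] //=.
  by rewrite expr0n eq_sym (negbTE c0).
- move=> z; rewrite !inE => z0; apply: E1; first by rewrite expf_eq0.
  by rewrite exprS exprMn conjK mulrC.
- rewrite cardE; apply: max_unity_roots; [lia| |exact: enum_uniq].
  by apply/allP => x; rewrite mem_enum inE unity_rootE.
- move=> y _; have nz : 'X^(q.+1) - y%:P != 0 :> {poly F}.
    by rewrite -size_poly_gt0 size_XnsubC.
  have := card_roots_lt nz; rewrite size_XnsubC // ltnS.
  apply: leq_trans; rewrite subset_leq_card //; apply/subsetP => x; rewrite !inE.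
  by rewrite rootE !hornerE subr_eq0 => /andP[].
- by rewrite cardsC1 hF; nia.
- by rewrite inE E1.
Qed.

Lemma norm_fixed (x : F) : (x ^+ q.+1) ^+ q = x ^+ q.+1.
Proof. by rewrite exprS exprMn conjK mulrC. Qed.

(** For a = 0 only b = 0 is a solution, and each of the q^2 - 1 other values of a allows q + 1
    values of b. The summand q on the left avoids subtraction. *)
Lemma card_norm_sum2 :
  (#|[set x : F * F | (x.1 ^+ q.+1 + x.2 ^+ q.+1 == 0)%R]| + q = q ^ 2 * q.+1)%N.
Proof.
rewrite -sum1dep_card -(pair_big_dep xpredT
  (fun a b => a ^+ q.+1 + b ^+ q.+1 == 0) (fun _ _ => 1%N)) /=.
have E (a : F) : (\sum_(b : F | (a ^+ q.+1 + b ^+ q.+1 == 0)%R) 1)%N = if a == 0 then 1%N else q.+1.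
  rewrite sum1dep_card -[a == 0](_ : (- a ^+ q.+1 == 0) = _).
    rewrite -card_norm; last by rewrite conjN norm_fixed.
    by apply: eq_card => b; rewrite !inE addrC addr_eq0.
  by rewrite oppr_eq0 expf_eq0.
rewrite (eq_bigr _ (fun a _ => E a)) (bigD1 0) //= eqxx.
rewrite (eq_bigr (fun => q.+1)) => [|a /negbTE-> //].
have := cardsC1 (0 : F); rewrite sum_nat_const hF => H.
rewrite (_ : #|_| = (q ^ 2).-1); first by have := q_gt1; nia.
by rewrite -H; apply: eq_card => x; rewrite !inE.
Qed.

Lemma card_norm_sum3 :
  (#|[set x : F * F * F | (x.1.1 ^+ q.+1 + x.1.2 ^+ q.+1 + x.2 ^+ q.+1 == 0)%R]| + q ^ 3
   = q ^ 5 + q ^ 2)%N.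
Proof.
rewrite -sum1dep_card -(pair_big_dep xpredT
  (fun a b => a.1 ^+ q.+1 + a.2 ^+ q.+1 + b ^+ q.+1 == 0) (fun _ _ => 1%N)) /=.
(* The last coordinate has q + 1 values, or just one if the first two norms cancel. Adding q in that
   case makes the count uniform, and the corrections add up to q times the number in
   [card_norm_sum2]. *)
have E (a : F * F) : (\sum_(b : F | (a.1 ^+ q.+1 + a.2 ^+ q.+1 + b ^+ q.+1 == 0)%R) 1
    + q * ((a.1 ^+ q.+1 + a.2 ^+ q.+1 == 0)%R : bool) = q.+1)%N.
  rewrite sum1dep_card -oppr_eq0.
  have -> : #|[set b | a.1 ^+ q.+1 + a.2 ^+ q.+1 + b ^+ q.+1 == 0]|
      = #|[set b | b ^+ q.+1 == - (a.1 ^+ q.+1 + a.2 ^+ q.+1)]|.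
    by apply: eq_card => b; rewrite !inE addrC addr_eq0.
  rewrite card_norm; last by rewrite conjN conjD !norm_fixed.
  by case: (_ == _); rewrite ?muln1 ?muln0 ?addn0 ?add1n.
have := @eq_bigr nat 0%N addn _ (index_enum _) xpredT _ _ (fun a _ => E a).
rewrite big_split /= -big_distrr /= sum_nat_const card_prod hF -big_mkcond /= sum1dep_card.
move: (congr1 (muln q) card_norm_sum2).
by move: #|_| (\sum_i _)%N => Z S; lia.
Qed.
End Conjugation.

(** * Points and lines of the projective plane by linear algebra *)

Section Plane.
Variables (F : finFieldType).
Implicit Types (u v w x : vec F).

Lemma dotDl u v w : dot (u + v) w = dot u w + dot v w.
Proof. by rewrite -big_split; apply: eq_bigr => i _; rewrite mxE mulrDl. Qed.

Lemma dotZl a u w : dot (a *: u) w = a * dot u w.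
Proof. by rewrite [RHS]mulr_sumr; apply: eq_bigr => i _; rewrite mxE mulrA. Qed.

Lemma dot0l w : dot 0 w = 0.
Proof. by apply: big1 => i _; rewrite mxE mul0r. Qed.

Lemma dotC u v : dot u v = dot v u.
Proof. by apply: eq_bigr => i _; rewrite mulrC. Qed.

Lemma dotDr u v w : dot w (u + v) = dot w u + dot w v.
Proof. by rewrite !(dotC w) dotDl. Qed.

Lemma dotZr a u w : dot w (a *: u) = a * dot w u.
Proof. by rewrite !(dotC w) dotZl. Qed.

Lemma mulmx_dot u w : u *m w^T = (dot u w)%:M.
Proof.
by apply/matrixP => i j; rewrite !ord1 !mxE mulr1n; apply: eq_bigr => k _; rewrite mxE.
Qed.

Lemma sub_ker_dot u w : (u <= kermx w^T)%MS = (dot u w == 0).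
Proof. by rewrite sub_kermx mulmx_dot -scalemx1 scaler_eq0 oner_eq0 orbF. Qed.

Lemma mem_pt v : v \in pt v.
Proof. by apply/imsetP; exists 1; rewrite ?scale1r. Qed.

Lemma pt_scale a v : a != 0 -> pt (a *: v) = pt v.
Proof.
move=> a0; apply/setP => x; apply/imsetP/imsetP => -[b _ ->].
  by exists (b * a); rewrite ?scalerA.
by exists (b / a); rewrite // scalerA divfK.
Qed.

Lemma pt_eqP u v : u != 0 -> reflect (exists a, u = a *: v) (pt u == pt v).
Proof.
move=> u0; apply: (iffP eqP) => [E|[a E]].
  by have := mem_pt u; rewrite E => /imsetP[a _ ->]; exists a.
rewrite E pt_scale //; apply: contraNneq u0 => a0.
by rewrite E a0 scale0r.
Qed.

Lemma line_scale a w : a != 0 -> line (a *: w) = line w.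
Proof.
move=> a0; rewrite /line (_ : [set v | _] = [set v | (v != 0) && (dot v w == 0)]) //.
by apply/setP => v; rewrite !inE dotZr mulf_eq0 (negbTE a0).
Qed.

Lemma mem_line v w : v != 0 -> (pt v \in line w) = (dot v w == 0).
Proof.
move=> v0; apply/imsetP/idP => [[u]|E]; last by exists v; rewrite // inE v0 E.
rewrite inE => /andP[u0 /eqP uw] /eqP/(pt_eqP _ v0)[a ->].
by rewrite dotZl uw mulr0.
Qed.

Lemma lineP p w : p \in line w -> exists v, [/\ v != 0, dot v w = 0 & p = pt v].
Proof.
by case/imsetP => v; rewrite inE => /andP[v0 /eqP vw] ->; exists v.
Qed.

Lemma rank_span2 u v : u != 0 -> v != 0 -> pt u != pt v -> \rank (u + v)%MS = 2.
Proof.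
move=> u0 v0 ne; apply/eqP; rewrite eqn_leq; apply/andP; split.
  by apply: leq_trans (mxrank_adds_leqif u v) _; rewrite !rank_rV u0 v0.
have uv := mxrank_leqif_sup (addsmxSl u v).
have := uv; rewrite /leqif rank_rV u0 => -[le1].
rewrite ltn_neqAle le1 => ->; rewrite andbT; apply: contra ne => E.
rewrite eq_sym; apply/(pt_eqP _ v0)/sub_rVP.
exact: submx_trans (addsmxSr u v) E.
Qed.

(** The space orthogonal to [w] has dimension 2 and contains the span of [u] and [v], which also has
    dimension 2. *)
Lemma span_of_line u v w x : u != 0 -> v != 0 -> pt u != pt v -> w != 0 ->
  dot u w = 0 -> dot v w = 0 -> dot x w = 0 -> exists a b, x = a *: u + b *: v.
Proof.
move=> u0 v0 ne w0 uw vw xw.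
have sub : (u + v <= kermx w^T)%MS by rewrite addsmx_sub !sub_ker_dot uw vw eqxx.
have xs : (x <= u + v)%MS.
  have xk : (x <= kermx w^T)%MS by rewrite sub_ker_dot xw.
  apply: submx_trans xk _.
  by rewrite -(mxrank_leqif_sup sub) mxrank_ker mxrank_tr rank_rV w0 rank_span2.
have [[a b] /= ->] := sub_addsmxP xs.
by exists (a 0 0), (b 0 0); rewrite [a]mx11_scalar [b]mx11_scalar !mul_scalar_mx !mxE !mulr1n.
Qed.

(** The vectors orthogonal to [u] and [v] form a space of dimension 3 - 2 = 1, so [w] spans it. *)
Lemma line_unique u v w w' : u != 0 -> v != 0 -> pt u != pt v -> w != 0 ->
  dot u w = 0 -> dot v w = 0 -> dot u w' = 0 -> dot v w' = 0 -> exists a, w' = a *: w.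
Proof.
move=> u0 v0 ne w0 uw vw uw' vw'; apply/sub_rVP.
have ker x : dot u x = 0 -> dot v x = 0 -> (x <= kermx (u + v)%MS^T)%MS.
  move=> ux vx; rewrite sub_kermx -trmx_eq0 trmx_mul trmxK -sub_kermx.
  by rewrite addsmx_sub !sub_ker_dot ux vx eqxx.
apply: submx_trans (ker w' uw' vw') _.
rewrite -(mxrank_leqif_sup (ker w uw vw)) mxrank_ker mxrank_tr rank_rV w0.
by rewrite rank_span2.
Qed.

Lemma line_through u v : exists w, [/\ w != 0, dot u w = 0 & dot v w = 0].
Proof.
set K := kermx (u + v)%MS^T; exists (nz_row K).
have : (nz_row K <= K)%MS by exact: nz_row_sub.
rewrite sub_kermx -trmx_eq0 trmx_mul trmxK -sub_kermx addsmx_sub !sub_ker_dot.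
move=> /andP[/eqP-> /eqP->]; split=> //; rewrite nz_row_eq0 -mxrank_eq0.
rewrite mxrank_ker mxrank_tr subn_eq0 -ltnNge.
apply: leq_ltn_trans (mxrank_adds_leqif u v) _; rewrite !rank_rV.
by case: (_ != _); case: (_ != _).
Qed.

Lemma meet_lines w w' p p' : w != 0 -> w' != 0 -> line w != line w' ->
  p \in line w -> p \in line w' -> p' \in line w -> p' \in line w' -> p = p'.
Proof.
move=> w0 w'0 ne /lineP[u [u0 uw ->]] + /lineP[v [v0 vw ->]].
rewrite !mem_line // => /eqP uw' /eqP vw'; apply/eqP; apply: contraNT ne => ne.
have [a E] := line_unique u0 v0 ne w0 uw vw uw' vw'.
rewrite E line_scale //; apply: contraNneq w'0 => a0.
by rewrite E a0 scale0r.
Qed.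
End Plane.

(** * The Hermitian form, the unital and its secants *)

Section HermitianUnital.
Variables (F : finFieldType) (q : nat).
Hypotheses (hq : prime_power q) (hF : #|F| = (q ^ 2)%N).
Implicit Types (u v w x : vec F).

Definition conjv v : vec F := map_mx (fun a => a ^+ q) v.

(** In this form the polar line of the point [pt v] is [line (conjv v)]. *)
Definition herm u v : F := dot u (conjv v).

Lemma conjvK v : conjv (conjv v) = v.
Proof. by apply/rowP => i; rewrite !mxE (conjK hF). Qed.

Lemma conjv_neq0 v : v != 0 -> conjv v != 0.
Proof.
apply: contraNneq => E; rewrite -(conjvK v) E.
by apply/eqP/rowP => i; rewrite !mxE (conj0 _ hq).
Qed.

Lemma conjvZ a v : conjv (a *: v) = a ^+ q *: conjv v.
Proof. by apply/rowP => i; rewrite !mxE exprMn. Qed.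

Lemma conjvD u v : conjv (u + v) = conjv u + conjv v.
Proof. by apply/rowP => i; rewrite !mxE (conjD hq hF). Qed.

Lemma hermC u v : herm v u = herm u v ^+ q.
Proof.
rewrite /herm /dot !big_ord_recl !big_ord0 !mxE !(conjD hq hF) !exprMn !(conjK hF) (conj0 _ hq).
by congr (_ + (_ + (_ + _))); rewrite mulrC.
Qed.

Lemma hermDl u v w : herm (u + v) w = herm u w + herm v w.
Proof. exact: dotDl. Qed.

Lemma hermZl a u w : herm (a *: u) w = a * herm u w.
Proof. exact: dotZl. Qed.

Lemma hermDr u v w : herm w (u + v) = herm w u + herm w v.
Proof. by rewrite /herm conjvD dotDr. Qed.

Lemma hermZr a u w : herm w (a *: u) = a ^+ q * herm w u.
Proof. by rewrite /herm conjvZ dotZr. Qed.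

Lemma hermE v : herm v v = \sum_(i < 3) v 0 i ^+ q.+1.
Proof. by apply: eq_bigr => i _; rewrite mxE exprS. Qed.

Lemma mem_unital v : v != 0 -> (pt v \in unital F q) = (herm v v == 0).
Proof.
move=> v0; apply/imsetP/idP => [[u]|E]; last by exists v; rewrite // inE v0 -hermE.
rewrite inE -hermE => /andP[u0 /eqP uu] /eqP/(pt_eqP _ v0)[a ->].
by rewrite hermZl hermZr uu !mulr0.
Qed.

Lemma unitalP p : p \in unital F q -> exists v, [/\ v != 0, herm v v = 0 & p = pt v].
Proof.
by case/imsetP => v; rewrite inE -hermE => /andP[v0 /eqP vv] ->; exists v.
Qed.

(** Otherwise both points lie on the polars of both. Two distinct points lie on only one line, so
    the polars coincide, and undoing the conjugation makes [u] and [v] proportional. *)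
Lemma herm_neq0 u v : u != 0 -> v != 0 -> herm u u = 0 -> herm v v = 0 ->
  pt u != pt v -> herm u v != 0.
Proof.
move=> u0 v0 uu vv ne; apply/eqP => uv.
have vu : herm v u = 0 by rewrite hermC uv (conj0 _ hq).
have [a E] := line_unique u0 v0 ne (conjv_neq0 u0) uu vu uv vv.
case/negP: ne; rewrite eq_sym; apply/(pt_eqP _ v0); exists (a ^+ q).
by rewrite -(conjvK v) E conjvZ conjvK.
Qed.

(** Besides [pt u], the points of the line are those of v + t u, and such a vector is isotropic
    exactly when t h(u,v) has trace 0. By [card_trace0] this gives 1 + q points. *)
Lemma card_line_unital u v w : u != 0 -> v != 0 -> herm u u = 0 -> herm v v = 0 ->
  pt u != pt v -> w != 0 -> dot u w = 0 -> dot v w = 0 ->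
  #|line w :&: unital F q| = q.+1.
Proof.
move=> u0 v0 uu vv ne w0 uw vw; have uv := herm_neq0 u0 v0 uu vv ne.
pose S := [set s : F | s ^+ q + s == 0].
pose f s := pt (v + (s / herm u v) *: u).
have nz t : v + t *: u != 0.
  apply: contraNneq ne => E; rewrite eq_sym; apply/(pt_eqP _ v0); exists (- t).
  by rewrite scaleNr; apply/eqP; rewrite -addr_eq0 E.
have ind a b : a *: u + b *: v = 0 -> b = 0.
  move=> E; apply/eqP; apply: contraNT ne => b0; rewrite eq_sym; apply/(pt_eqP _ v0).
  exists (- a / b); rewrite mulrC -scalerA scaleNr.
  have -> : - (a *: u) = b *: v by apply/eqP; rewrite eq_sym -addr_eq0 addrC E.
  by rewrite scalerA mulVf // scale1r.
have iso t : herm (v + t *: u) (v + t *: u) = (t * herm u v) ^+ q + t * herm u v.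
  rewrite !(hermDl, hermDr, hermZl, hermZr) uu vv !mulr0 addr0 add0r exprMn.
  by rewrite -hermC.
have -> : line w :&: unital F q = pt u |: f @: S.
  apply/setP => p; rewrite in_setU1; apply/setIP/orP => [[/lineP[x [x0 xw ->]]]|].
    rewrite mem_unital // => xx.
    have [a [b E]] := span_of_line u0 v0 ne w0 uw vw xw.
    have [b0|b0] := eqVneq b 0.
      by left; apply/(pt_eqP _ x0); exists a; rewrite E b0 scale0r addr0.
    have Ex : x = b *: (v + (a / b) *: u).
      by rewrite scalerDr scalerA mulrCA divff // mulr1 addrC.
    right; apply/imsetP; exists (a / b * herm u v); last first.
      by rewrite /f mulfK // Ex pt_scale.
    rewrite inE -iso; move: xx; rewrite Ex hermZl hermZr !mulf_eq0 expf_eq0.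
    by rewrite (negbTE b0) andbF.
  case=> [/eqP->|/imsetP[s]]; first by rewrite mem_line // mem_unital // uw uu !eqxx.
  rewrite inE => /eqP Es ->; rewrite mem_line // mem_unital // iso divfK // Es eqxx.
  by rewrite dotDl dotZl uw vw mulr0 addr0 eqxx.
rewrite cardsU1 card_in_imset ?card_trace0 //.
  suff -> : pt u \notin f @: S by [].
  apply/negP => /imsetP[s _ /eqP]; rewrite eq_sym => /(pt_eqP _ (nz _))[a E].
  have : (s / herm u v - a) *: u + 1 *: v = 0.
    by rewrite scale1r scalerBl addrAC [_ + v]addrC E subrr.
  by move/ind/eqP; rewrite oner_eq0.
move=> s t _ _ /eqP/(pt_eqP _ (nz _))[a E].
have ind' c d : c *: u + d *: v = 0 -> c *: u = 0.
  by move=> H; have d0 := ind _ _ H; move: H; rewrite d0 scale0r addr0.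
have H : (s / herm u v - a * (t / herm u v)) *: u + (1 - a) *: v = 0.
  move/eqP: E; rewrite -subr_eq0 => /eqP <-.
  by apply/rowP => i; rewrite !mxE; ring.
have /eqP a1 := ind _ _ H; have /eqP := ind' _ _ H.
rewrite scaler_eq0 (negbTE u0) orbF; move: a1; rewrite subr_eq0 => /eqP <-.
by rewrite mul1r subr_eq0 => /eqP/(mulIf _); apply; rewrite invr_eq0.
Qed.

Lemma card_pt v : v != 0 -> #|pt v :\ 0| = (q ^ 2).-1.
Proof.
move=> v0; rewrite -hF -(card_imset _ (_ : injective (fun a : F => a *: v))).
  rewrite [in RHS](cardsD1 0) (_ : 0 \in _) //.
  by apply/imsetP; exists 0; rewrite ?scale0r.
move=> a b /eqP; rewrite -subr_eq0 -scalerBl scaler_eq0 (negbTE v0) orbF subr_eq0.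
by move/eqP.
Qed.

Lemma card_isotropic : (#|[set v : vec F | herm v v == 0%R]| + q ^ 3 = q ^ 5 + q ^ 2)%N.
Proof.
rewrite -(card_norm_sum3 hq hF); congr (_ + _)%N.
pose f (x : F * F * F) : vec F := \row_(i < 3) nth 0 [:: x.1.1; x.1.2; x.2] i.
have finj : injective f.
  move=> [[a b] c] [[a' b'] c'] /rowP E.
  have := (E 0, E 1, E 2%:R); rewrite !mxE /=.
  by case=> -[-> ->] ->.
rewrite -(card_imset _ finj); apply: eq_card => v; rewrite inE.
apply/idP/imsetP => [H|[[[a b] c]]]; last first.
  rewrite inE /= => H ->; rewrite hermE !big_ord_recl big_ord0 !mxE /= addr0 addrA.
  exact: H.
have Ev : v = f (v 0 0, v 0 1, v 0 2%:R).
  apply/rowP => i; rewrite !mxE; case: i => -[|[|[|//]]] lt /=;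
  by congr (v _ _); apply: val_inj.
exists (v 0 0, v 0 1, v 0 2%:R); last exact: Ev.
move: H; rewrite inE hermE {1}Ev !big_ord_recl big_ord0 !mxE /= addr0 addrA.
by [].
Qed.

(** Each point carries q^2 - 1 nonzero vectors, and the number of nonzero isotropic vectors factors
    as q^5 - q^3 + q^2 - 1 = (q^2 - 1)(q^3 + 1). *)
Lemma card_unital : #|unital F q| = (q ^ 3).+1.
Proof.
have q1 := q_gt1 hq; pose A := [set v : vec F | (v != 0) && (herm v v == 0)].
have EU : unital F q = @pt F @: A.
  rewrite /unital (_ : [set v | _] = A) //.
  by apply/setP => v; rewrite !inE hermE.
have cA : (#|A| = #|unital F q| * (q ^ 2).-1)%N.
  rewrite -sum1_card (partition_big_imset (@pt F)) /= -EU -sum_nat_const.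
  apply: eq_bigr => p pU; have [v [v0 vv ->]] := unitalP pU.
  rewrite -(card_pt v0) sum1dep_card; apply: eq_card => x; rewrite !inE.
  have [->|x0] /= := eqVneq x 0; first by [].
  apply/andP/imsetP => [[_ /(pt_eqP _ x0)[a ->]]|[a _ E]]; first by exists a.
  have H : pt x == pt v by apply/(pt_eqP _ x0); exists a.
  by split; rewrite // E hermZl hermZr vv !mulr0.
have c0 : (#|[set v : vec F | herm v v == 0%R]| = #|A|.+1)%N.
  rewrite (cardsD1 0) inE /herm /dot big1 => [|i _]; last by rewrite mxE mul0r.
  by rewrite eqxx; congr _.+1; apply: eq_card => v; rewrite !inE.
have := card_isotropic; rewrite c0 cA; move: #|unital F q| => N H.
have /eqP : ((q ^ 2).-1 * N = (q ^ 2).-1 * (q ^ 3).+1)%N.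
  by move: (q ^ 2)%N (erefl (q ^ 2)%N); nia.
by rewrite eqn_mul2l => /orP[|/eqP//]; nia.
Qed.

(* The radical of the alternating Gram matrix on a, b, c is spanned by
   h(b,c) a + h(c,a) b + h(a,b) c; this vector is nonzero if a is not on bc. *)
Lemma isotropic_differences a b c w : b != 0 -> c != 0 -> pt b != pt c ->
  herm a a = 0 -> herm b b = 0 -> herm c c = 0 ->
  herm (b - c) (b - c) = 0 -> herm (c - a) (c - a) = 0 -> herm (b - a) (b - a) = 0 ->
  w != 0 -> dot b w = 0 -> dot c w = 0 -> dot a w = 0.
Proof.
move=> b0 c0 ne aa bb cc bc ca ba w0 bw cw.
have skew x y : herm x x = 0 -> herm y y = 0 -> herm (x - y) (x - y) = 0 ->
    herm y x = - herm x y.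
  move=> xx yy; rewrite -scaleN1r !(hermDl, hermDr, hermZl, hermZr) xx yy.
  rewrite (conjN hq hF) expr1n !mulr0 add0r addr0 !mulN1r => /eqP.
  by rewrite addr_eq0 opprK => /eqP->.
have cb := skew _ _ bb cc bc; have ac := skew _ _ cc aa ca; have ab := skew _ _ bb aa ba.
have n0 := herm_neq0 b0 c0 bb cc ne.
apply/eqP; apply/negP => /negP aw.
pose v := herm b c *: a + herm c a *: b + herm a b *: c.
have v0 : v != 0.
  have : dot v w != 0 by rewrite !dotDl !dotZl bw cw !mulr0 !addr0 mulf_neq0.
  by apply: contraNneq => ->; rewrite dot0l.
have orth x : herm v x = 0 -> dot x (conjv v) = 0.
  by move=> vx; rewrite -/(herm x v) hermC vx (conj0 _ hq).
have va : dot a (conjv v) = 0.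
  by apply: orth; rewrite !(hermDl, hermZl) aa ab; ring.
have vb : dot b (conjv v) = 0.
  by apply: orth; rewrite !(hermDl, hermZl) bb cb ab; ring.
have vc : dot c (conjv v) = 0.
  by apply: orth; rewrite !(hermDl, hermZl) cc ac; ring.
have [k E] := line_unique b0 c0 ne w0 bw cw vb vc.
have k0 : k != 0.
  by apply: contraNneq (conjv_neq0 v0) => k0; rewrite E k0 scale0r.
by move/eqP: va; rewrite E dotZr mulf_eq0 (negbTE k0) (negbTE aw).
Qed.

(** The lines [l1], [l2], [l3] are the sides of the triangle [A], [B], [C], and [l4] cuts them in
    [D], [E], [G]. Representatives of the corners are scaled so that their differences represent
    [D], [E], [G]; then [isotropic_differences] puts [A] on [l1]. *)
Lemma no_onan_configuration (l1 l2 l3 l4 : {set {set vec F}}) (A B C D E G : {set vec F}) :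
  [/\ l1 \in @lines F, l2 \in @lines F, l3 \in @lines F & l4 \in @lines F] ->
  [/\ A \in unital F q, B \in unital F q & C \in unital F q] ->
  [/\ D \in unital F q, E \in unital F q & G \in unital F q] ->
  [/\ B \in l1, C \in l1, D \in l1 & A \notin l1] ->
  [/\ A \in l2, C \in l2, E \in l2 & B \notin l2] ->
  [/\ A \in l3, B \in l3, G \in l3 & C \notin l3] ->
  [/\ D \in l4, E \in l4 & G \in l4] ->
  [/\ A \notin l4, B \notin l4 & C \notin l4] -> False.
Proof.
case=> /imsetP[w1 + ->] /imsetP[w2 + ->] /imsetP[w3 + ->] /imsetP[w4 + ->].
rewrite !inE => w10 w20 w30 w40.
case=> /unitalP[a [a0 aa ->]] /unitalP[b [b0 bb ->]] /unitalP[c [c0 cc ->]].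
case=> /unitalP[d [d0 dd ->]] /unitalP[e [e0 ee ->]] /unitalP[g [g0 gg ->]].
rewrite !mem_line // => -[/eqP bw1 /eqP cw1 /eqP dw1 aw1].
move=> [/eqP aw2 /eqP cw2 /eqP ew2 bw2] [/eqP aw3 /eqP bw3 /eqP gw3 cw3].
move=> [/eqP dw4 /eqP ew4 /eqP gw4] [aw4 bw4 cw4].
have pne x y w : x != 0 -> dot x w = 0 -> dot y w != 0 -> pt x != pt y.
  move=> x0 xw yw; have y0 : y != 0 by apply: contraNneq yw => ->; rewrite dot0l.
  apply: contra yw => /eqP/esym/eqP E1.
  by move/(pt_eqP _ y0): E1 => [k ->]; rewrite dotZl xw mulr0.
have bc : pt b != pt c by apply: (pne _ _ w3).
have ca : pt c != pt a by apply: (pne _ _ w1).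
have ba : pt b != pt a by apply: (pne _ _ w1).
have [x [y Ed]] := span_of_line b0 c0 bc w10 bw1 cw1 dw1.
have [z [t Ee]] := span_of_line c0 a0 ca w20 cw2 aw2 ew2.
(* The four coefficients are nonzero because [l4] passes through none of the corners: otherwise [D]
   or [E] would be a corner. *)
have x0 : x != 0.
  apply: contraNneq cw4 => x0; move: dw4; rewrite Ed x0 scale0r add0r dotZl => /eqP.
  rewrite mulf_eq0 => /orP[/eqP y0|//].
  by move: d0; rewrite Ed x0 y0 !scale0r addr0 eqxx.
have y0 : y != 0.
  apply: contraNneq bw4 => y0; move: dw4; rewrite Ed y0 scale0r addr0 dotZl => /eqP.
  by rewrite mulf_eq0 (negbTE x0).
have z0 : z != 0.
  apply: contraNneq aw4 => z0; move: ew4; rewrite Ee z0 scale0r add0r dotZl => /eqP.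
  rewrite mulf_eq0 => /orP[/eqP t0|//].
  by move: e0; rewrite Ee z0 t0 !scale0r addr0 eqxx.
have t0 : t != 0.
  apply: contraNneq cw4 => t0; move: ew4; rewrite Ee t0 scale0r addr0 dotZl => /eqP.
  by rewrite mulf_eq0 (negbTE z0).
(* rescaling, so that d = b' - c' and e is proportional to c' - a' *)
pose b' := x *: b; pose c' := - y *: c; pose a' := (y * t / z) *: a.
have Ed' : d = b' - c' by rewrite Ed /b' /c' scaleNr opprK.
have Ee' : - (y / z) *: e = c' - a'.
  rewrite Ee /c' /a' !scaleNr scalerDr !scalerA divfK // opprD.
  by congr (_ - _ *: _); rewrite mulrAC.
have nza : y * t / z != 0 by rewrite !mulf_neq0 ?invr_eq0.
have sc k u : herm u u = 0 -> herm (k *: u) (k *: u) = 0.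
  by move=> uu; rewrite hermZl hermZr uu !mulr0.
have ba'0 : b' - a' != 0.
  rewrite subr_eq0; apply: contra aw1 => /eqP E1.
  move: (congr1 (fun u => dot u w1) E1); rewrite /b' /a' !dotZl bw1 mulr0 => /esym/eqP.
  by rewrite mulf_eq0 (negbTE nza).
(* The difference b' - a' lies on [l3] as a combination of a and b, and on [l4] as a combination of
   d and e, so it represents the point [G] common to these lines. *)
have bag : pt (b' - a') = pt g.
  have l34 : line w3 != line w4.
    by apply: contra aw4 => /eqP E1; rewrite -mem_line // -E1 mem_line // aw3.
  apply: (meet_lines w30 w40 l34); rewrite mem_line // ?gw3 ?gw4 //.
    by rewrite -scaleN1r dotDl !dotZl bw3 aw3 !mulr0 addr0.
  have -> : b' - a' = d + - (y / z) *: e by rewrite Ed' Ee' addrA subrK.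
  by rewrite dotDl dotZl dw4 ew4 mulr0 addr0.
have ba'h : herm (b' - a') (b' - a') = 0.
  by move/eqP/(pt_eqP _ ba'0): bag => [k ->]; apply: sc.
case/negP: aw1; have : dot a' w1 == 0; last by rewrite dotZl mulf_eq0 (negbTE nza).
apply/eqP; apply: (@isotropic_differences a' b' c' w1) => //; try exact: sc.
- by rewrite scaler_eq0 negb_or x0.
- by rewrite scaler_eq0 negb_or oppr_eq0 y0.
- by rewrite !pt_scale ?oppr_eq0.
- by rewrite -Ed'.
- by rewrite -Ee'; apply: sc.
- by rewrite dotZl bw1 mulr0.
- by rewrite dotZl cw1 mulr0.
Qed.

Lemma secantP l : l \in secants F q ->
  exists w, [/\ w != 0, l = line w & #|l :&: unital F q| = q.+1].
Proof.
rewrite inE => /andP[/imsetP[w]]; rewrite inE => w0 El /eqP cl.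
by exists w.
Qed.

Lemma secant_through A B : A \in unital F q -> B \in unital F q -> A != B ->
  exists l, [/\ l \in secants F q, A \in l & B \in l].
Proof.
move=> /unitalP[u [u0 uu ->]] /unitalP[v [v0 vv ->]] ne.
have [w [w0 uw vw]] := line_through u v.
exists (line w); rewrite !mem_line // uw vw eqxx; split=> //.
by rewrite inE (card_line_unital u0 v0 uu vv ne w0 uw vw) eqxx imset_f ?inE.
Qed.

Lemma secant_meet l m A B : l \in secants F q -> m \in secants F q -> l != m ->
  A \in l -> A \in m -> B \in l -> B \in m -> A = B.
Proof.
by move=> /secantP[w [w0 -> _]] /secantP[w' [w'0 -> _]]; apply: meet_lines.
Qed.

(** Distinct secants share at most one point, so the arbitrary choice in [meet] returns their common
    point, and two meets on one side agree exactly when the three lines are concurrent. *)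
Lemma Tq_nondeg_triangles : Tq F q = nondeg_triangles (unital F q) (secants F q).
Proof.
rewrite /nondeg_triangles -[triangles _ (adj _)]/(triangles (secants F q) (@Hadj F q)).
apply/setP => t; rewrite in_set [RHS]in_set.
have [tT|] //= := boolP (t \in triangles (secants F q) (@Hadj F q)).
move: tT; rewrite inE => /and3P[/subsetP tL /eqP ct /forall_inP adjt].
have meetE a b A : a \in t -> b \in t -> a != b -> A \in a -> A \in b -> meet a b = Some A.
  move=> /tL aL /tL bL ab Aa Ab; rewrite /meet; case: pickP => [B|/(_ A)].
    by rewrite inE => /andP[Ba Bb]; rewrite (secant_meet aL bL ab Ba Bb Aa Ab).
  by rewrite inE Aa Ab.
apply/idP/idP => [/forall_inP nd|/forallP nd].
  apply/forallP => A; apply: contraT; rewrite negb_exists_in => /forall_inP all.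
  have [a at_] : exists a, a \in t by apply/set0Pn; rewrite -card_gt0 ct.
  have [b [c [Et ab ac bc]]] := cards3_mem ct at_.
  have bt : b \in t by rewrite Et !inE eqxx orbT.
  have ct' : c \in t by rewrite Et !inE eqxx !orbT.
  have /forall_inP/(_ b bt)/forall_inP/(_ c ct') := nd a at_.
  rewrite ab ac bc /= (meetE a b A) ?(meetE a c A) ?eqxx //;
  exact/negPn/all.
apply/forall_inP => a at_; apply/forall_inP => b bt; apply/forall_inP => c ct'.
apply/implyP => /and3P[ab ac bc]; apply/negP => /eqP E.
have inter (x y : {set {set vec F}}) : x \in t -> y \in t -> x != y -> exists A, A \in x /\ A \in y.
  move=> xt yt xy; have /forall_inP/(_ y yt) := adjt _ xt.
  by rewrite xy /Hadj xy /= => /set0Pn[A]; rewrite !inE => /andP[/andP[]]; exists A.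
have [A [Aa Ab]] := inter _ _ at_ bt ab; have [B [Ba Bc]] := inter _ _ at_ ct' ac.
move: E; rewrite (meetE a b A) // (meetE a c B) // => -[E]; subst B.
have Et : t = [set a; b; c].
  apply/esym/eqP; rewrite eqEcard; apply/andP; split.
    by apply/subsetP => x; rewrite !inE => /orP[/orP[]|] /eqP->.
  by rewrite ct setUC cardsU1 cards2 ab !inE negb_or [c == a]eq_sym ac [c == b]eq_sym bc.
have /exists_inP[l] := nd A.
by rewrite Et !inE => /orP[/orP[]|] /eqP->; rewrite ?Aa ?Ab ?Bc.
Qed.

(** If all four triangles were non-degenerate, no three of the four secants would be concurrent, and
    their pairwise meets would form the configuration excluded by [no_onan_configuration]. *)
Lemma Tq_K4_free (K : {set {set {set vec F}}}) : is_K4 (secants F q) (@Hadj F q) K ->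
  ~ (forall t : {set _}, t \subset K -> #|t| = 3%N -> t \in Tq F q).
Proof.
move=> /and3P[/subsetP KL /eqP cK /forall_inP adjK]; rewrite Tq_nondeg_triangles => KT.
have [l4 l4K] : exists l, l \in K by apply/set0Pn; rewrite -card_gt0 cK.
have cK3 : #|K :\ l4| = 3%N by have := cardsD1 l4 K; rewrite l4K cK add1n => -[].
have [l1 l1K] : exists l, l \in K :\ l4 by apply/set0Pn; rewrite -card_gt0 cK3.
have [l2 [l3 [EK n12 n13 n23]]] := cards3_mem cK3 l1K.
have : l2 \in K :\ l4 by rewrite EK !inE eqxx orbT.
have : l3 \in K :\ l4 by rewrite EK !inE eqxx !orbT.
move: l1K; rewrite !in_setD1 => /andP[n14 l1K] /andP[n34 l3K] /andP[n24 l2K].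
have point (x y : {set {set vec F}}) : x \in K -> y \in K -> x != y ->
    exists A, [/\ A \in unital F q, A \in x & A \in y].
  move=> xK yK xy; have /forall_inP/(_ y yK) := adjK _ xK.
  by rewrite xy /Hadj xy /= => /set0Pn[A]; rewrite !inE => /andP[/andP[]]; exists A.
have off (x y z : {set {set vec F}}) A : x \in K -> y \in K ->
    z \in K -> x != y -> x != z -> y != z -> A \in x -> A \in y -> A \notin z.
  move=> xK yK zK xy xz yz Ax Ay.
  have : [set x; y; z] \in nondeg_triangles (unital F q) (secants F q).
    apply: KT; first by apply/subsetP => u; rewrite !inE => /orP[/orP[]|] /eqP->.
    by rewrite setUC cardsU1 cards2 xy !inE negb_or [z == x]eq_sym xz [z == y]eq_sym yz.
  rewrite in_set => /andP[_ /forallP/(_ A)/exists_inP[l]].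
  by rewrite !inE => /orP[/orP[]|] /eqP->; rewrite ?Ax ?Ay.
have isline l : l \in K -> l \in @lines F by move/KL; rewrite inE => /andP[].
have [A [AU A2 A3]] := point _ _ l2K l3K n23; have [B [BU B1 B3]] := point _ _ l1K l3K n13.
have [C [CU C1 C2]] := point _ _ l1K l2K n12; have [D [DU D1 D4]] := point _ _ l1K l4K n14.
have [E [EU E2 E4]] := point _ _ l2K l4K n24; have [G [GU G3 G4]] := point _ _ l3K l4K n34.
have n21 : l2 != l1 by rewrite eq_sym.
have n31 : l3 != l1 by rewrite eq_sym.
have n32 : l3 != l2 by rewrite eq_sym.
apply: (@no_onan_configuration l1 l2 l3 l4 A B C D E G); split=> //; try exact: isline.
- exact: (off l2 l3).
- exact: (off l1 l3).
- exact: (off l1 l2).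
- exact: (off l2 l3).
- exact: (off l1 l3).
- exact: (off l1 l2).
Qed.

Lemma card_secants : #|secants F q| = (q ^ 4 - q ^ 3 + q ^ 2)%N.
Proof.
have q1 := q_gt1 hq.
have cb l : l \in secants F q -> #|l :&: unital F q| = q.+1 by case/secantP => w [].
have := card_lines cb secant_through secant_meet card_unital.
move: #|secants F q| => S H.
(* With q = p + 1 the truncated difference q^4 - q^3 becomes the product p (p + 1)^3, and q (q + 1)
   can be cancelled. *)
have Eq : q = q.-1.+1 by lia.
move: q.-1 Eq H => p ->; move=> H.
have /eqP : (p.+2 * p.+1 * S = p.+2 * p.+1 * (p.+1 ^ 4 - p.+1 ^ 3 + p.+1 ^ 2))%N.
  have -> : (p.+1 ^ 4 - p.+1 ^ 3 + p.+1 ^ 2 = p * p.+1 ^ 3 + p.+1 ^ 2)%N.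
    by rewrite (expnS _ 3) mulSn addKn.
  by lia.
by rewrite eqn_mul2l => /orP[|/eqP].
Qed.

Lemma card_nonmono_Tq (c : {set {set {set vec F}}} -> bool) :
  (4 * q * #|[set t in Tq F q | ~~ monochromatic c t]| <= 3 * q.+1 * #|Tq F q|)%N.
Proof.
have cb l : l \in secants F q -> #|l :&: unital F q| = q.+1 by case/secantP => w [].
rewrite Tq_nondeg_triangles.
exact: (card_nonmono cb secant_through secant_meet card_unital).
Qed.

Lemma card_Tq_gt0 : (0 < #|Tq F q|)%N.
Proof.
have q1 := q_gt1 hq.
have cb l : l \in secants F q -> #|l :&: unital F q| = q.+1 by case/secantP => w [].
rewrite Tq_nondeg_triangles.
have S0 : (0 < #|secants F q|)%N by rewrite card_secants addn_gt0 expn_gt0 (ltnW q1) orbT.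
have q3 : (0 < q ^ 3 - q)%N by rewrite subn_gt0 -{1}(expn1 q) ltn_exp2l.
rewrite -(ltn_pmul2l (isT : 0 < 6)%N) muln0.
apply: leq_trans (card_nondeg_triangles cb secant_through secant_meet card_unital).
by rewrite !muln_gt0 S0 q3 (ltnW q1).
Qed.
End HermitianUnital.

(** * From the bound on non-monochromatic triangles to existence and asymptotics *)

Theorem theorem1 :
  (forall (F : finFieldType) (q : nat),
     prime_power q -> (4 <= q)%N -> #|F| = (q ^ 2)%N ->
     #|secants F q| = (q ^ 4 - q ^ 3 + q ^ 2)%N /\
     quasi_folkman_with (secants F q) (@Hadj F q) (Tq F q)) /\
  (forall eps : rat, (0 < eps)%R ->
     exists Q : nat, forall (F : finFieldType) (q : nat),
       prime_power q -> (Q <= q)%N -> #|F| = (q ^ 2)%N ->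
       forall c : {set {set {set vec F}}} -> bool,
         ((1 / 4 - eps) * (#|Tq F q|)%:R <=
            (#|[set t in Tq F q | monochromatic c t]|)%:R)%R).
Proof.
have split_mono (F : finFieldType) q (c : {set {set {set vec F}}} -> bool) :
    (#|[set t in Tq F q | monochromatic c t]| +
     #|[set t in Tq F q | ~~ monochromatic c t]| = #|Tq F q|)%N.
  rewrite -(cardsID [set t | monochromatic c t] (Tq F q)).
  by congr (_ + _)%N; apply: eq_card => t; rewrite in_set [RHS]in_set in_set // andbC.
split=> [F q hq q4 hF|eps eps0].
  split; first exact: card_secants.
  split; first by apply/subsetP => t; rewrite in_set => /andP[].
    exact: Tq_K4_free.
  move=> c; have := split_mono F q c; have := card_nonmono_Tq hq hF c.
  have := card_Tq_gt0 hq hF.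
  (* Without a monochromatic triangle the bound would read 4 q |T| <= 3 (q + 1) |T| with |T| > 0,
     hence q <= 3. *)
  have [->|[t]] := set_0Vmem [set t in Tq F q | monochromatic c t].
    by rewrite cards0; nia.
  by rewrite in_set => /andP[]; exists t.
(* The monochromatic fraction is at least 1/4 - 3/(4q), so eps q >= 1 suffices; the successor also
   ensures q > 0. *)
exists (Num.bound eps^-1).+1 => F q hq Qq hF c.
have H1 := split_mono F q c; have H2 := card_nonmono_Tq hq hF c.
have q0 : (0 < q%:R :> rat)%R by rewrite ltr0n (leq_trans _ Qq).
have qe : (1 <= eps * q%:R :> rat)%R.
  rewrite mulrC -ler_pdivrMr // mul1r.
  apply: ltW; apply: lt_le_trans (archi_boundP _) _; first by rewrite invr_ge0 ltW.
  by rewrite ler_nat ltnW.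
move: H1 H2; set M := #|[set t in _ | monochromatic _ _]|.
move: #|[set t in _ | ~~ _]| #|Tq F q| => N T H1 H2.
have {}H1 : (M%:R + N%:R = T%:R :> rat)%R by rewrite -natrD H1.
have {}H2 : (4 * q%:R * N%:R <= 3 * (q%:R + 1) * T%:R :> rat)%R.
  by rewrite -!natrM natr1 -!natrM ler_nat.
have T0 : (0 <= T%:R :> rat)%R by rewrite ler0n.
rewrite -(ler_pM2l q0); nra.
Qed.
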